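(* Let $\sigma,\kappa>0$, $v\ge0$, let $\vartheta$ be a bijective path in $C_0(\mathbb{R}_+,\mathbb{R}_+)$, and let $Z=\{Z_x\}_{x\in\mathbb{R}_+}$ be a stochastic process on $(\Omega,\mathcal{F},\mathbb{P})$ with paths a.s. in $C_0(\mathbb{R}_+,\mathbb{R})$ and a.s. verifying $\sup_{x\in\mathbb{R}_+}(\kappa x-\sigma Z_x)=\infty$. Let $Y_{t,x}:=\sigma Z_x+\kappa(\vartheta(t)-x)+v$ and let $X=\{X_t\}_{t\in\mathbb{R}_+}$ be the unique solution of the random initial value problem $x'=Y_{t,x}$, $x_0=0$. Write $Y_{t,x}=\tilde{\vartheta}(t)-\tilde{Z}_x$ where $\tilde{\vartheta}:=\kappa\vartheta$ and $\tilde{Z}_x:=\kappa x-\sigma Z_x-v$, and let $\overline{X}_t:=\inf\{x>0:Y_{t,x}<0\}$. Fix $p,T>0$. Provided that the left tails of $\tilde{Z}$ (thus the right tails of $Z$) are thin enough to be dominated in the sense that $$\exists\,a,b,c>0\ \text{ such that }\ \log\mathbb{P}[\tilde{Z}_x<\tilde{\vartheta}(T)]<a-(p+b)x\quad\forall\,x\in[c,\infty),$$ the moment generating function $M_{\overline{X}}(p,t):=\mathbb{E}[e^{p\overline{X}_t}]$ exists (is finite) for $t\in[0,T]$, and likewise for $M_X(p,t):=\mathbb{E}[e^{pX_t}]$.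
   Context: $\mathbb{R}_+=[0,\infty)$; $C_0$ denotes continuous paths starting from $0$ at $0$. Convention $\log 0=-\infty$. A process $X$ is the solution of the random initial value problem $x'=Y_{t,x}$, $x_0=0$ if almost surely $X_0=0$, $X$ is continuously differentiable on $\mathbb{R}_+$ and $X'_t=Y_{t,X_t}$ for all $t\in\mathbb{R}_+$. For $Y$ as in the statement such a solution exists, is unique up to indistinguishability, a.s. has paths that are bijections in $C^1_0(\mathbb{R}_+,\mathbb{R}_+)$, and is dominated by $\overline{X}$, i.e. $X_t\le\overline{X}_t$ for all $t$.
   Formalization: Finiteness of the moment generating function of X̄ at t=T fails in general (Z̃ may stay at ϑ̃(T)); it is proved for t<T, and at t=T only if the same exponential bound holds for P[Z̃_x ≤ ϑ̃(T)]. For X all t in [0,T] are covered. *)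

(* Defs.v *)
From HB Require Import structures.
From mathcomp Require Export all_boot all_order all_algebra.
From mathcomp Require Export all_classical all_reals all_analysis.
From mathcomp Require Import ring.

Set Implicit Arguments.
Unset Strict Implicit.
Unset Printing Implicit Defensive.

Import Order.TTheory GRing.Theory Num.Theory.
Import numFieldNormedType.Exports.

Local Open Scope classical_set_scope.
Local Open Scope ring_scope.

(* Paths and processes indexed by the half-line [0, +oo) are functions on the
   whole of R of which only the values at nonnegative arguments are ever used. *)
Section Paths.
Context {R : realType}.

Definition halfline : set R := `[0, +oo[%classic.

Definition C0_path (f : R -> R) : Prop :=
  f 0 = 0 /\ {within halfline, continuous f}.

Definition bijective_C0_path (f : R -> R) : Prop :=
  C0_path f /\ set_bij halfline halfline f.

(* Derivative relative to [0, +oo): two-sided for t > 0, from the right at 0. *)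
Definition is_derive_halfline (x : R -> R) (t l : R) : Prop :=
  (x s - x t) / (s - t) @[s --> within halfline (dnbhs t)] --> l.

(* y t x is only meaningful for t, x >= 0, so that a solution has to take its
   values in [0, +oo). *)
Definition ivp_solution (y : R -> R -> R) (x : R -> R) : Prop :=
  [/\ x 0 = 0,
      forall t, 0 <= t -> 0 <= x t &
      exists x' : R -> R,
        {within halfline, continuous x'} /\
        forall t, 0 <= t -> is_derive_halfline x t (x' t) /\ x' t = y t (x t)].

(* The pathwise quantities; z stands for a path x |-> Z_x(w). *)
Definition Yfield (sigma kappa v : R) (theta z : R -> R) (t x : R) : R :=
  sigma * z x + kappa * (theta t - x) + v.

Definition theta_tilde (kappa : R) (theta : R -> R) (t : R) : R :=
  kappa * theta t.

Definition Z_tilde (sigma kappa v : R) (z : R -> R) (x : R) : R :=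
  kappa * x - sigma * z x - v.

Lemma YfieldE (sigma kappa v : R) (theta z : R -> R) (t x : R) :
  Yfield sigma kappa v theta z t x =
  theta_tilde kappa theta t - Z_tilde sigma kappa v z x.
Proof. by rewrite /Yfield /theta_tilde /Z_tilde; ring. Qed.

(* Extended-real valued: the infimum of the empty set is +oo. *)
Definition Xbar (sigma kappa v : R) (theta z : R -> R) (t : R) : \bar R :=
  ereal_inf [set x%:E | x in
    [set x | 0 < x /\ Yfield sigma kappa v theta z t x < 0]].

End Paths.

(* E[exp(p W)] for an extended-real valued W. The integrand is nonnegative, so
   that the integral is the supremum of the integrals of the nonnegative
   simple functions below it; if W is only almost surely equal to a measurable
   W', this is still the integral of exp(p W'). *)
Definition mgf_ereal {d : measure_display} {Omega : measurableType d}
    {R : realType} (P : probability Omega R) (W : Omega -> \bar R) (p : R)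
    : \bar R :=
  (\int[P]_w expeR (p%:E * W w))%E.

(* Main.v *)
(* If X_t > a, then at the last time s < t at which X <= a the path X is at a
   with nonnegative slope, so Z_tilde_a <= theta_tilde(s) < theta_tilde(T). If
   Xbar_t > a, then Z_tilde_a <= theta_tilde(t) by the definition of the
   infimum. Hence the tails of X_t and of Xbar_t are bounded by a multiple of
   exp(-(p+b)a), and exp(pW) <= 1 + sum_n exp(p(n+1)) 1_{W > n} turns this into
   a convergent geometric series. *)
Require Import Defs.
From mathcomp Require Import ring lra measurable_realfun.
Import Order.TTheory GRing.Theory Num.Theory.
Import numFieldNormedType.Exports.

Local Open Scope classical_set_scope.
Local Open Scope ring_scope.

(** * Pathwise facts: monotonicity of the clock and level crossings *)

Section Paths.
Set Implicit Arguments.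
Unset Strict Implicit.
Context {R : realType}.
Implicit Types (x theta : R -> R) (y : R -> R -> R).

(** A continuous injection on an interval is strictly monotone, and [theta 0 = 0 <= theta 1] rules
    out the decreasing case. *)
Lemma bijective_C0_path_increasing theta (theta_bij : bijective_C0_path theta) :
  forall s t, 0 <= s -> 0 <= t -> (theta s < theta t) = (s < t).
Proof.
have [[theta0 theta_cont] [theta_fun theta_inj _]] := theta_bij.
have memE s : (s \in halfline) = (0 <= s).
  by apply/idP/idP; rewrite /halfline inE /= in_itv /= andbT.
have mono : {in `[0, +oo[ &, {mono theta : s t / s <= t}}.
  apply: itv_continuous_inj_le => //.
    exists 0, 1; rewrite !in_itv /= !andbT lexx ler01 ltr01; split => //.
    rewrite theta0; have /theta_fun : halfline (1 : R).
      by apply: set_mem; rewrite memE.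
    by move=> /mem_set; rewrite memE.
  move=> s t; rewrite !in_itv /= !andbT => s0 t0.
  by apply: theta_inj; rewrite memE.
move=> s t s0 t0.
by apply: (leW_mono_in mono); rewrite in_itv /= andbT.
Qed.

Lemma at_right_halfline (s : R) : 0 <= s ->
  s^'+ `=>` within halfline s^'.
Proof.
move=> s0 B; rewrite /at_right /dnbhs /within /= !nearE /=.
apply: filterS => u /= BP su; apply: BP; first by rewrite gt_eqF.
by rewrite /halfline /= in_itv /= andbT (le_trans s0) // ltW.
Qed.

Lemma is_derive_halfline_cvg x (t l : R) : is_derive_halfline x t l ->
  x s @[s --> within halfline t^'] --> x t.
Proof.
move=> xl.
have st : (s - t) @[s --> within halfline t^'] --> 0.
  rewrite -[X in _ --> X](subrr t); apply: cvgB; last exact: cvg_cst.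
  by rewrite /dnbhs; do 2 apply: cvg_within_filter; exact: cvg_id.
(* Differentiability gives continuity: the quotient times [s - t], plus [x t], is [x s] off [t]. *)
have xt : (x s - x t) / (s - t) * (s - t) + x t @[s --> within halfline t^']
    --> x t.
  rewrite -[X in _ --> X]add0r -[X in _ --> X + _](mulr0 l).
  by apply: cvgD (cvg_cst _); exact: cvgM.
apply: cvg_trans xt; apply: near_eq_cvg.
rewrite near_withinE; near=> s => _ /=; rewrite divfK ?subrK // subr_eq0; near: s.
exact: nbhs_dnbhs_neq.
Unshelve. all: by end_near. Qed.

(* The crossing time is the last time before [t] at which the path is at
   most [a]. *)
Lemma ivp_solution_upcrossing y x (t a : R) :
  ivp_solution y x -> 0 <= t -> 0 <= a -> a < x t ->
  exists s, [/\ 0 <= s, s < t & 0 <= y s a].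
Proof.
move=> [x0 _ [x' [_ xx']]] t0 a0 axt.
pose E := [set u | [/\ 0 <= u, u <= t & x u <= a]].
have E0 : E 0 by split; rewrite ?x0.
have ubE : ubound E t by move=> u [].
have supE : has_sup E by split; [exists 0 | exists t].
pose s := sup E.
have s0 : 0 <= s by apply: ub_le_sup => //; exists t.
have st : s <= t by apply: ge_sup => //; exists 0.
have [xs xsE] := xx' _ s0.
have x_cvg := is_derive_halfline_cvg xs.
(* The supremum belongs to [E]: if [x s] exceeded [a], so would [x] near [s], against points of [E]
   arbitrarily close to [s] from the left. *)
have xs_le : x s <= a.
  rewrite leNgt; apply/negP => axs.
  have [e /= e0 He] := cvgr_gt _ x_cvg _ axs.
  have [u [u0 ut xua] su] := sup_adherent e0 supE; rewrite -/s in su.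
  have us : u <= s by apply: ub_le_sup => //; exists t.
  (* The limit is taken over a punctured neighbourhood, so [u = s] is excluded by hand. *)
  have [usE|uNs] := eqVneq u s; first by move: axs; rewrite -usE ltNge xua.
  have : a < x u.
    apply: He => //=; last by rewrite /halfline /= in_itv /= andbT.
    by rewrite ger0_norm ?subr_ge0 // ltrBlDl -ltrBlDr.
  by rewrite ltNge xua.
have s_lt : s < t.
  by rewrite lt_neqAle st andbT; apply: contraTneq axt => <-; rewrite -leNgt.
(* Since [s < t], points just right of [s] still lie below [t], hence outside [E]. *)
have above : \forall u \near s^'+, s < u /\ a < x u.
  near=> u; have su : s < u by [].
  split => //; rewrite ltNge; apply/negP => xua.
  have : u <= s.
    apply: ub_le_sup; first by exists t.
    split => //; first by rewrite (le_trans s0) // ltW.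
    by near: u; apply: nbhs_right_le.
  by rewrite leNgt su.
have xsa : x s = a.
  apply/eqP; rewrite eq_le xs_le /=.
  apply: (@cvgr_to_ge _ (s^'+) _ _ x).
    exact: cvg_trans (cvg_app _ (at_right_halfline s0)) x_cvg.
  by apply: filterS above => u [_ /ltW].
(* Now [y s a] is the derivative of [x] at [s], a limit from the right of nonnegative quotients. *)
exists s; split => //; rewrite -[a in y s a]xsa -xsE.
apply: (@cvgr_to_ge _ (s^'+) _ _ (fun u => (x u - x s) / (u - s))).
  exact: cvg_trans (cvg_app _ (at_right_halfline s0)) xs.
apply: filterS above => u [su axu].
by rewrite divr_ge0 // subr_ge0 ?xsa ltW.
Unshelve. all: by end_near. Qed.

Lemma Xbar_gt (sigma kappa v : R) theta (z : R -> R) (t a : R) :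
  0 < a -> (a%:E < Xbar sigma kappa v theta z t)%E ->
  Z_tilde sigma kappa v z a <= theta_tilde kappa theta t.
Proof.
move=> a0; rewrite -subr_ge0 -YfieldE leNgt; apply: contraTN => Ya.
by rewrite -leNgt; apply: ereal_inf_lbound; exists a.
Qed.

Lemma Z_tilde0 (sigma kappa v : R) (z : R -> R) :
  C0_path z -> Z_tilde sigma kappa v z 0 = - v.
Proof. by move=> [z0 _]; rewrite /Z_tilde z0; ring. Qed.

End Paths.

(** * From exponential tail bounds to finite exponential moments *)

Section ExponentialMoment.
Set Implicit Arguments.
Unset Strict Implicit.
Context {d : measure_display} {Omega : measurableType d} {R : realType}.
Local Open Scope ereal_scope.

Import HBNNSimple.

(* Unlike in ae_ge0_le_integral, [f] need not be measurable: nothing makes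
   [Xbar] measurable, since the paths of [Z] are continuous only almost surely. *)
Lemma ge0_le_integral_ae_nonmeasurable (mu : {measure set Omega -> \bar R})
    (f g : Omega -> \bar R) :
  (forall w, 0 <= f w) -> (forall w, 0 <= g w) -> measurable_fun setT g ->
  {ae mu, forall w, f w <= g w} ->
  \int[mu]_w f w <= \int[mu]_w g w.
Proof.
move=> f0 g0 mg fg; rewrite ge0_integralTE //.
apply: ge_ereal_sup => _ [h /= hf <-]; rewrite -integralT_nnsfun.
apply: ae_ge0_le_integral => //.
- by move=> w _; rewrite lee_fin.
- by apply/measurable_EFinP.
- by apply: filterS fg => w fgw _; apply: le_trans (hf w) fgw.
Qed.

Variable P : probability Omega R.
Implicit Types (W : Omega -> \bar R) (A : nat -> set Omega).

(* For n < W <= n+1 the n-th term alone dominates. *)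
Lemma expeR_le_nneseries A W (p : R) (w : Omega) : (0 < p)%R ->
  (forall n, n%:R%:E < W w -> A n w) ->
  expeR (p%:E * W w) <=
    1 + \sum_(n <oo) (expR (p * n.+1%:R) * \1_(A n) w)%:E.
Proof.
move=> p0 AW; set S := (X in 1 + X).
have term0 n : 0 <= (expR (p * n.+1%:R) * \1_(A n) w)%:E.
  by rewrite lee_fin mulr_ge0 ?expR_ge0.
have S0 : 0 <= S by apply: nneseries_ge0.
have term_le n : n%:R%:E < W w -> (expR (p * n.+1%:R))%:E <= S.
  move=> /AW Anw; apply: le_trans (nneseries_lim_ge n.+1 _); last by [].
  rewrite big_nat_recr //= indicE mem_set // mulr1.
  by rewrite leeDr // sume_ge0.
have S_le : S <= 1 + S by rewrite leeDr.
case WE : (W w) => [r| |].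
(* Take the least natural number bounding [r]. If it is 0, then [r <= 0] and the summand 1 suffices;
   if it is [n.+1], then [n < r <= n.+1]. *)
- have /ex_minnP[[|n] rn minn] : exists n, (r <= n%:R)%R.
  + exists (Num.bound r); apply: ltW; apply: le_lt_trans (ler_norm _) _.
    by have := archi_boundP (normr_ge0 r); rewrite /Num.bound normr_id.
  + apply: (@le_trans _ _ 1); last by rewrite leeDl.
    by rewrite -expeR0 lee_expeR mule_ge0_le0 ?lee_fin // ltW.
  + apply: le_trans S_le; apply: le_trans (term_le n _); last first.
      rewrite WE lte_fin ltNge; apply/negP => /minn.
      by rewrite ltnn.
    by rewrite /= lee_fin ler_expR ler_pM2l.
(* When [W w = +oo] every term is at most [S], and the terms are unbounded because
   [expR y >= 1 + y]. *)
- suff -> : S = +oo by rewrite addey ?leey.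
  apply/eqyP => r r0; pose n := Num.bound (r / p).
  apply: le_trans (term_le n _); last by rewrite WE ltry.
  rewrite lee_fin; apply: le_trans (expR_ge1Dx _).
  apply: (@le_trans _ _ (p * n%:R)%R).
    by rewrite mulrC -ler_pdivrMr // ltW // archi_boundP // divr_ge0 // ltW.
  by rewrite -natr1 mulrDr mulr1; lra.
- by rewrite gt0_muleNy ?lte_fin //= adde_ge0.
Qed.

(** Termwise integration leaves at most [C * expR (p * n.+1) * expR (- (p + b) * n)], which equals
    [C * expR p * expR (- b) ^+ n]: the excess [b] of the tail rate over [p] is the decay rate of
    the geometric series. *)
Lemma mgf_ereal_fin_num A W (p b C : R) :
  (0 < p)%R -> (0 < b)%R ->
  (forall n, measurable (A n)) ->
  (forall n, P (A n) <= (C * expR (- (p + b) * n%:R))%:E) ->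
  {ae P, forall w, forall n, n%:R%:E < W w -> A n w} ->
  mgf_ereal P W p \is a fin_num.
Proof.
move=> p0 b0 mA PA AW.
have term0 n w : 0 <= (expR (p * n.+1%:R) * \1_(A n) w)%:E.
  by rewrite lee_fin mulr_ge0 ?expR_ge0.
have mterm n : measurable_fun setT
    (fun w => (expR (p * n.+1%:R) * \1_(A n) w)%:E).
  by apply/measurable_EFinP; apply: measurable_funM.
pose g w := 1 + \sum_(n <oo) (expR (p * n.+1%:R) * \1_(A n) w)%:E.
have mS : measurable_fun setT
    (fun w => \sum_(n <oo) (expR (p * n.+1%:R) * \1_(A n) w)%:E).
  exact: (@ge0_emeasurable_sum _ _ _ _ _ xpredT).
have S0 w : 0 <= \sum_(n <oo) (expR (p * n.+1%:R) * \1_(A n) w)%:E.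
  by apply: nneseries_ge0.
rewrite /mgf_ereal ge0_fin_numE; last first.
  by apply: integral_ge0 => w _; exact: expeR_ge0.
have le_g : \int[P]_w expeR (p%:E * W w) <= \int[P]_w g w.
  apply: ge0_le_integral_ae_nonmeasurable.
  - by move=> w; exact: expeR_ge0.
  - by move=> w; rewrite adde_ge0.
  - exact: emeasurable_funD.
  - by apply: filterS AW => w AWw; exact: expeR_le_nneseries.
apply: le_lt_trans le_g _.
have int1 : \int[P]_w (cst 1 w) = 1.
  by rewrite integral_cst // mul1e; exact: probability_setT.
rewrite ge0_integralD // int1.
rewrite lte_add_pinfty ?ltry // (integral_nneseries P measurableT mterm) //.
apply: (@le_lt_trans _ _
    (\sum_(n <oo) (geometric (C * expR p) (expR (- b)) n)%:E)).
  apply: lee_nneseries => [n _ _|n _]; first exact: integral_ge0.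
  under eq_integral do rewrite EFinM.
  rewrite ge0_integralZl_EFin ?expR_ge0 //; last first.
    by apply/measurable_EFinP; exact: measurable_indic.
  rewrite integral_indic // setIT.
  apply: le_trans (lee_wpmul2l _ (PA n)) _; first by rewrite lee_fin expR_ge0.
  rewrite -EFinM lee_fin le_eqVlt; apply/orP; left; apply/eqP.
  rewrite /= -expRM_natl mulrCA -mulrA -!expRD.
  by congr (_ * expR _)%R; rewrite -natr1 -[RHS]/(p + _)%R; ring.
have lt1 : (`|expR (- b)| < 1)%R.
  by rewrite ger0_norm ?expR_ge0 // expR_lt1 oppr_lt0.
have cvgS := @is_cvg_geometric_series R (C * expR p) _ lt1.
rewrite (_ : (fun n => _) =
    EFin \o series (geometric (C * expR p) (expR (- b)))).
  by rewrite EFin_lim // ltry.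
by apply/funext => n; rewrite /= /series /= sumEFin.
Qed.

(** The constant [expR a] serves from [c] on; below [c], [expR (q * c)] makes the bound at least
    1. *)
Lemma probability_le_exp_of_lne (A : R -> set Omega) (a q c : R) :
  (forall x, measurable (A x)) -> (0 < q)%R ->
  (forall x, (c <= x)%R -> lne (P (A x)) < (a - q * x)%:E) ->
  forall x, P (A x) <= (Num.max (expR a) (expR (q * c)) * expR (- q * x))%:E.
Proof.
move=> mA q0 PA x; have [cx|xc] := leP c x.
- have PAx := PA _ cx.
  (* This covers null events too, as [lne 0 = -oo] and [expeR -oo = 0]. *)
  rewrite -[P (A x)](eqP (_ : expeR (lne (P (A x))) == P (A x))) ?lneK_eq //.
  apply: (@le_trans _ _ (expeR (a - q * x)%:E)).
    by rewrite lee_expeR ltW.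
  rewrite /= lee_fin expRD mulNr ler_wpM2r ?expR_ge0 //.
  by rewrite le_max lexx.
- apply: le_trans (probability_le1 P (mA x)) _.
  apply: (@le_trans _ _ (expR (q * c) * expR (- q * x))%:E).
    rewrite -expRD lee_fin -expR0 ler_expR mulNr -mulrBr.
    by rewrite mulr_ge0 ?subr_ge0 // ltW.
  by rewrite lee_fin ler_wpM2r ?expR_ge0 // le_max lexx orbT.
Qed.

Lemma mgf_ereal_fin_num_of_lne (A : R -> set Omega) W (p a b c : R) :
  (0 < p)%R -> (0 < b)%R ->
  (forall x, measurable (A x)) ->
  (forall x, (c <= x)%R -> lne (P (A x)) < (a - (p + b) * x)%:E) ->
  {ae P, forall w, forall x, (0 <= x)%R -> x%:E < W w -> A x w} ->
  mgf_ereal P W p \is a fin_num.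
Proof.
move=> p0 b0 mA PA AW.
apply: (@mgf_ereal_fin_num (fun n => A n%:R) W p b) => //.
- by move=> n; apply: probability_le_exp_of_lne PA _ => //; rewrite addr_gt0.
- by apply: filterS AW => w AWw n; exact: AWw.
Qed.

(** Lets the solution and its dominating process share one moment estimate. *)
Lemma mmt_gen_fun_mgf_ereal (X : {RV P >-> R}) (p : R) :
  'M_P X p = mgf_ereal P (fun w => (X w)%:E) p.
Proof.
rewrite /mmt_gen_fun unlock; apply: eq_integral => w _ /=.
by rewrite mulrC.
Qed.

End ExponentialMoment.

(* At t = T the bound on P[Z_tilde_x < theta_tilde(T)] does not control Xbar_T:
   Xbar_T is the first passage strictly above theta_tilde(T), and Z_tilde may
   stay equal to theta_tilde(T) for a long time. Hence the separate endpoint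
   clause, under the bound on P[Z_tilde_x <= theta_tilde(T)]. *)
Theorem mainTheorem11 (R : realType) (d : measure_display)
  (Omega : measurableType d) (P : probability Omega R)
  (sigma kappa v : R) (sigma_gt0 : 0 < sigma) (kappa_gt0 : 0 < kappa)
  (v_ge0 : 0 <= v)
  (theta : R -> R) (theta_bij : bijective_C0_path theta)
  (Z : R -> {RV P >-> R})
  (Z_C0 : {ae P, forall w, C0_path (fun x => Z x w)})
  (Z_sup : {ae P, forall w,
     ereal_sup [set (kappa * x - sigma * Z x w)%:E | x in halfline] = +oo%E})
  (X : R -> {RV P >-> R})
  (X_sol : {ae P, forall w,
     ivp_solution (Yfield sigma kappa v theta (fun x => Z x w))
                  (fun t => X t w)})
  (p T : R) (p_gt0 : 0 < p) (T_gt0 : 0 < T)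
  (Z_tail : exists a b c : R, [/\ 0 < a, 0 < b, 0 < c &
     forall x, c <= x ->
       (lne (P [set w | (Z_tilde sigma kappa v (fun y => Z y w) x
                           < theta_tilde kappa theta T)%R])
         < (a - (p + b) * x)%:E)%E]) :
  [/\ forall t, 0 <= t -> t <= T -> 'M_P (X t) p \is a fin_num,
      forall t, 0 <= t -> t < T ->
        mgf_ereal P
          (fun w => Xbar sigma kappa v theta (fun x => Z x w) t) p
          \is a fin_num &
      (exists a b c : R, [/\ 0 < a, 0 < b, 0 < c &
         forall x, c <= x ->
           (lne (P [set w | (Z_tilde sigma kappa v (fun y => Z y w) x
                               <= theta_tilde kappa theta T)%R])
             < (a - (p + b) * x)%:E)%E]) ->
      mgf_ereal P
        (fun w => Xbar sigma kappa v theta (fun x => Z x w) T) p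
        \is a fin_num].
Proof.
have theta_incr := bijective_C0_path_increasing theta_bij.
have theta_tilde_lt s t : 0 <= s -> s < t ->
    theta_tilde kappa theta s < theta_tilde kappa theta t.
  move=> s0 st; rewrite /theta_tilde ltr_pM2l // theta_incr //.
  by rewrite (le_trans s0) // ltW.
have theta_tilde_ge0 t : 0 <= t -> 0 <= theta_tilde kappa theta t.
  rewrite le_eqVlt => /predU1P[<-|t0].
    by rewrite /theta_tilde theta_bij.1.1 mulr0.
  apply: ltW; apply: le_lt_trans (theta_tilde_lt _ _ (lexx 0) t0).
  by rewrite /theta_tilde theta_bij.1.1 mulr0.
have mZ x : measurable_fun setT
    (fun w => Z_tilde sigma kappa v (fun y => Z y w) x).
  by apply: measurable_funB => //; apply: measurable_funB => //;
     apply: measurable_funM.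
have mlt (c x : R) : measurable
    [set w | Z_tilde sigma kappa v (fun y => Z y w) x < c].
  by have := mZ x measurableT _ (measurable_itv `]-oo, c[);
     rewrite setTI; congr measurable; apply/seteqP; split => w /=; rewrite in_itv.
have mle (c x : R) : measurable
    [set w | Z_tilde sigma kappa v (fun y => Z y w) x <= c].
  by have := mZ x measurableT _ (measurable_itv `]-oo, c]);
     rewrite setTI; congr measurable; apply/seteqP; split => w /=; rewrite in_itv.
have Xbar_le t : 0 <= t -> {ae P, forall w, forall x, 0 <= x ->
    (x%:E < Xbar sigma kappa v theta (fun y => Z y w) t)%E ->
    Z_tilde sigma kappa v (fun y => Z y w) x <= theta_tilde kappa theta t}.
  move=> t0; apply: filterS Z_C0 => w Zw x.
  (* The infimum runs over [x > 0] only, so level 0 is checked directly: there [Z_tilde] is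
     [- v <= 0]. *)
  rewrite le_eqVlt => /predU1P[<- _|]; last exact: Xbar_gt.
  by rewrite Z_tilde0 // (le_trans _ (theta_tilde_ge0 _ t0)) // oppr_le0.
have [a [b [c [_ b0 _ tail]]]] := Z_tail; split.
- move=> t t0 tT; rewrite mmt_gen_fun_mgf_ereal.
  apply: mgf_ereal_fin_num_of_lne tail _ => //.
  apply: filterS X_sol => w Xw x x0; rewrite lte_fin => xX.
  have [s [s0 st]] := ivp_solution_upcrossing Xw t0 x0 xX.
  (* The crossing time satisfies [s < t <= T], so the strict event at [T] is reached even for
     [t = T]. *)
  rewrite YfieldE subr_ge0 => /le_lt_trans; apply.
  by apply: theta_tilde_lt => //; exact: lt_le_trans tT.
- move=> t t0 tT; apply: mgf_ereal_fin_num_of_lne tail _ => //.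
  (* Here strictness comes from [t < T] instead. *)
  apply: filterS (Xbar_le _ t0) => w Xw x x0 /(Xw _ x0) /le_lt_trans; apply.
  exact: theta_tilde_lt.
- move=> [a' [b' [c' [_ b'0 _ tail']]]].
  apply: mgf_ereal_fin_num_of_lne tail' _ => //.
  exact: Xbar_le (ltW T_gt0).
Qed.
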